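(* Let $d\ge 2$ and $n \ge 2$ be integers, let $A \in \mathrm{GL}_d(\mathbb{Z})$ be hyperbolic, and let $\mu$ be a probability measure on $\mathbb{Z}^d$ with finite entropy $H(\mu)$. Let $(B_t)_{t\ge1}$ be i.i.d. random variables with law $\mu$ and let $(X_t)_{t\ge 0}$ be the random walk on $(\mathbb{Z}/n\mathbb{Z})^d$ defined by $X_0=0$ and $X_t = A X_{t-1} + B_t \bmod n$ for $t \ge 1$. Let $P^t(0,\cdot)$ be the law of $X_t$ and $U$ the uniform measure on $(\mathbb{Z}/n\mathbb{Z})^d$. Then for all integers $t \ge 0$, $$\left\| P^t(0,\cdot) - U\right\|_{\mathrm{TV}} \ge 1 - \frac{t H(\mu) + \log 2}{\log n}.$$
   Context: $\mathrm{GL}_d(\mathbb{Z})$ is the set of invertible $d\times d$ matrices with integer entries whose inverse has integer entries. A matrix is hyperbolic if it has no eigenvalue of modulus $1$. The entropy of a probability measure $p$ on a discrete set $X$ is $H(p) = -\sum_{x \in X} p_x \log p_x$ (with $0\log 0=0$), where $\log$ is the natural logarithm. For probability measures $p,q$ on a finite set $X$, $\|p-q\|_{\mathrm{TV}} = \max_{S \subseteq X} |p(S)-q(S)| = \frac12 \sum_{x\in X} |p(x)-q(x)|$. *)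

(* Defs.v *)
From HB Require Import structures.
From mathcomp Require Import all_boot all_order all_algebra.
From mathcomp Require Import finmap complex.
From mathcomp Require Import all_classical all_reals all_analysis.

Set Implicit Arguments.
Unset Strict Implicit.
Unset Printing Implicit Defensive.

Import Order.TTheory GRing.Theory Num.Theory.
Import numFieldNormedType.Exports.

Local Open Scope classical_set_scope.
Local Open Scope ring_scope.

(* Alias of T carrying the sigma-algebra of all subsets. *)
Definition discrete_space (T : Type) : Type := T.

HB.instance Definition _ (T : choiceType) := Choice.on (discrete_space T).
HB.instance Definition _ (T : pointedType) := Pointed.on (discrete_space T).
HB.instance Definition _ (T : pointedType) :=
  @isMeasurable.Build default_measure_display (discrete_space T)
    discrete_measurable discrete_measurable0 discrete_measurableC
    discrete_measurableU.

(* Measurable types are pointed; the chosen points play no role below. *)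
HB.instance Definition _ := isPointed.Build int 0.
HB.instance Definition _ (n : nat) := isPointed.Build 'I_n.+1 ord0.

(* The terms - p_x log p_x are nonnegative, so [esum] is their sum in any
   order, with value +oo when it diverges; [ln 0 = 0] by convention. *)
Definition entropy (R : realType) (T : pointedType)
    (p : probability (discrete_space T) R) : \bar R :=
  \esum_(x in [set: T])
    (- (fine (p [set x]) * ln (fine (p [set x]))))%:E.

Definition mutually_independent (disp disp' : measure_display)
    (Omega : measurableType disp) (S : measurableType disp') (R : realType)
    (P : probability Omega R) (K : choiceType) (I : set K)
    (X : K -> {RV P >-> S}) : Prop :=
  forall (J : {fset K}) (E : K -> set S),
    [set` J] `<=` I -> (forall i, i \in J -> measurable (E i)) ->
    P (\bigcap_(i in [set` J]) X i @^-1` E i) =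
      (\prod_(i <- J) P (X i @^-1` E i))%E.

(* Since every absolute value is nonnegative, the default value 0 of the
   iterated maximum is harmless. *)
Definition tv_dist (R : realType) (T : finType) (p q : set T -> \bar R) : R :=
  \big[Num.max/0]_(S : {set T}) `|fine (p [set` S]) - fine (q [set` S])|.

Definition uniform_measure (R : realType) (T : finType) (S : set T) : \bar R :=
  (#|[set x : T | x \in S]%SET|%:R / #|T|%:R)%:E.

Definition hyperbolic (R : realType) (d : nat) (A : 'M[int]_d) : Prop :=
  forall z : R[i],
    eigenvalue (map_mx intr A : 'M[R[i]]_d) z -> `|z| != 1.

(* [map_mx intr] is entrywise reduction modulo n. The type 'Z_n is Z/nZ only
   for n >= 2. *)
Fixpoint walk (d n : nat) (A : 'M[int]_d) (b : nat -> 'cV[int]_d) (t : nat) :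
    'cV['Z_n]_d :=
  if t is t'.+1
  then map_mx intr A *m walk n A b t' + map_mx intr (b t'.+1)
  else 0.

(* Main.v *)
Require Import Defs.
From mathcomp Require Import all_boot all_order all_algebra.
From mathcomp Require Import finmap complex.
From mathcomp Require Import all_classical all_reals all_analysis measurable_realfun.

Set Implicit Arguments.
Unset Strict Implicit.
Unset Printing Implicit Defensive.

Import Order.TTheory GRing.Theory Num.Theory.
Import numFieldNormedType.Exports.

Local Open Scope classical_set_scope.
Local Open Scope ring_scope.

(** The random walk can only be close to uniform if it is spread over most of
    (Z/nZ)^d, and it cannot be, because with high probability it sits at an atom
    of its law that is too heavy.

    Call - log mu(b) the surprisal of a step b; its mean under mu is H(mu)
    ([integral_surprisal]). By independence, the event that the first t steps
    take the values that they actually took has probability the product of the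
    mu(B_s), and on that event the walk is where it actually is. Hence, pointwise
    on the sample space,
      - log P(X_t = X_t(w)) <= sum_(1 <= s <= t) - log mu(B_s(w)),
    which is [neg_lne_walk_atom_le]. The right-hand side has mean t H(mu)
    ([integral_sum_surprisal]), so by Markov's inequality X_t(w) is an atom of
    mass less than 1/n with probability at most t H(mu) / log n.

    Let S be the set of atoms of mass at least 1/n. It has at most n elements, so
    U(S) <= n / n^d <= 1/n <= log 2 / log n, where the second inequality uses
    d >= 2 and the third n <= 2^n. Testing the total variation distance on S
    ([tv_dist_uniform_ge]) gives the bound. The surprisal takes the value +oo at
    null atoms, which makes the pointwise inequality true on the whole sample
    space without changing the mean. *)

(** * Surprisal and entropy on a countable discrete space *)

Section discrete.
Context (R : realType) (T : pointedType).

(** The fibres of an injection into nat cut the space into countably many pieces,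
    each empty or a single point; sigma-additivity of the integral over them
    gives the sum over all points. *)
Lemma ge0_integral_discrete
    (mu : {measure set (discrete_space T) -> \bar R}) (f : T -> \bar R) :
  countable [set: T] -> (forall x, 0 <= f x)%E ->
  (\int[mu]_x f x = \esum_(x in [set: T]) (f x * mu [set x]))%E.
Proof.
move=> /countable_injP[e einj] f0.
pose F k : set (discrete_space T) := [set x | e x = k].
have FT : \bigcup_k F k = setT by apply/seteqP; split=> // x _; exists (e x).
have Ftriv : trivIset setT F.
  by move=> i j _ _ [x [<- <-]].
have F_set1 x : F (e x) = [set x].
  apply/seteqP; split=> y /=; last by move=> ->.
  by move=> eyx; apply: einj; rewrite ?inE.
have f_mu x : (\int[mu]_(y in [set x]) f y = f x * mu [set x])%E.
  rewrite -integral_cst//; apply: eq_integral => y.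
  by rewrite inE => ->.
rewrite -[in LHS]FT ge0_integral_bigcup//.
rewrite nneseries_esumT; last by move=> k; apply: integral_ge0.
have <- : \bigcup_k F k = [set: T] by [].
rewrite esum_bigcup//; last 2 first.
- by move=> i j _ _ [x [<- <-]].
- by move=> x _; rewrite mule_ge0.
apply: eq_esum => k _.
have [->|/set0P[x Fkx]] := eqVneq (F k) set0.
  by rewrite integral_set0 esum_set0.
by rewrite -Fkx F_set1 f_mu esum_set1// mule_ge0.
Qed.
End discrete.

Section surprisal.
Context (R : realType) (T : pointedType) (mu : probability (discrete_space T) R).

(** As [lne 0 = -oo], the surprisal of a null atom is +oo, whereas [entropy] uses
    the convention [ln 0 = 0]. *)
Definition surprisal (x : T) : \bar R := (- lne (mu [set x]))%E.

Lemma lne_le0 (x : \bar R) : (x <= 1)%E -> (lne x <= 0)%E.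
Proof.
move=> x1; have [x0|x0] := leP x 0%E; first by rewrite le0_lneNy.
by rewrite -[leRHS](@lne1 R) lee_lne // in_itv/= leey ?andbT // ltW.
Qed.

Lemma surprisal_ge0 x : (0 <= surprisal x)%E.
Proof. by rewrite oppe_ge0 lne_le0// probability_le1. Qed.

(** The two conventions at a null atom agree after weighting by its mass, since
    [+oo * 0 = 0]. *)
Lemma integral_surprisal : countable [set: T] ->
  (\int[mu]_x surprisal x = entropy mu)%E.
Proof.
move=> cT; rewrite ge0_integral_discrete//; last exact: surprisal_ge0.
apply: eq_esum => x _.
change ((- lne (mu [set x]) * mu [set x])%E =
  (- (fine (mu [set x]) * ln (fine (mu [set x]))))%:E).
have : mu [set x] \is a fin_num by exact: fin_num_measure.
have : (0 <= mu [set x])%E by [].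
case: (mu [set x]) => // p; rewrite lee_fin le_eqVlt => /predU1P[<-|p0] _.
  by rewrite mule0 mul0r oppr0.
by rewrite lne_EFin// -EFinN -EFinM mulNr mulrC.
Qed.
End surprisal.

(** For factors in [0, 1] the logarithm turns products into sums even when some
    factor vanishes: no negated logarithm is -oo, so a single +oo makes the whole
    sum +oo. *)
Lemma neg_lne_prod (R : realType) (t : nat) (x : nat -> \bar R) :
  (forall s, 0 <= x s <= 1)%E ->
  (- lne (\prod_(0 <= s < t) x s) = \sum_(0 <= s < t) - lne (x s))%E.
Proof.
move=> x01; elim: t => [|t IH]; first by rewrite !big_nil lne1 oppe0.
rewrite !big_nat_recr//= -IH; set y := (\prod_(_ <= _ < _) _)%E.
have /andP[y0 y1] : (0 <= y <= 1)%E.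
  rewrite /y; elim: (t) => [|u /andP[IH0 IH1]].
    by rewrite big_nil lee01 lexx.
  have /andP[xu0 xu1] := x01 u.
  by rewrite big_nat_recr//= mule_ge0//= -[leRHS]mule1 lee_pmul.
have /andP[z0 z1] := x01 t.
have gtNy (z : \bar R) : (z <= 1 -> - lne z != -oo)%E.
  by move=> /lne_le0; case: (lne z).
move: y0; rewrite le_eqVlt => /predU1P[y0|y0].
  by rewrite -y0 mul0e (le0_lneNy (lexx _)) addye // gtNy.
move: z0; rewrite le_eqVlt => /predU1P[z0|z0].
  by rewrite -z0 mule0 (le0_lneNy (lexx _)) addey // gtNy.
rewrite lneM ?in_itv/= ?leey ?y0 ?z0// oppeD//.
by move: (lne_le0 y1) (lne_le0 z1); case: (lne y) => [?||]; case: (lne _).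
Qed.

(** * The law of the walk *)

Lemma eq_walk (d n : nat) (A : 'M[int]_d) (b b' : nat -> 'cV[int]_d) t :
  (forall s, (s < t)%N -> b s.+1 = b' s.+1) -> walk n A b t = walk n A b' t.
Proof.
elim: t => //= t IH eb; rewrite eb// IH// => s st.
by apply: eb; rewrite ltnW.
Qed.

Section walk.
Context (R : realType) (d n : nat) (A : 'M[int]_d).
Context (disp : measure_display) (Omega : measurableType disp)
  (P : probability Omega R).
Context (B : nat -> {RV P >-> discrete_space 'cV[int]_d}).

Let X (t : nat) (w : Omega) := walk n A (fun s => B s w) t.

Lemma measurable_preimage_RV s (S : set 'cV[int]_d) :
  measurable (B s @^-1` S).
Proof.
by rewrite -[_ @^-1` _]setTI; exact: (measurable_funP (B s)).
Qed.

(** The position takes finitely many values, so a step of the recursion splits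
    the event into finitely many events about the previous position and the
    residue of the new increment. *)
Lemma measurable_walk t (V : set 'cV['Z_n]_d) : measurable (X t @^-1` V).
Proof.
elim: t V => [|t IH] V.
  have [V0|V0] := pselect (V 0).
    by rewrite (_ : _ @^-1` _ = setT)//; apply/seteqP; split=> // w _.
  by rewrite (_ : _ @^-1` _ = set0)//; apply/seteqP; split=> // w.
pose D : set ('cV['Z_n]_d * 'cV['Z_n]_d) :=
  [set yz | V (map_mx intr A *m yz.1 + yz.2)].
pose E (yz : 'cV['Z_n]_d * 'cV['Z_n]_d) :=
  X t @^-1` [set yz.1] `&` B t.+1 @^-1` [set b | map_mx intr b = yz.2].
have -> : X t.+1 @^-1` V = \bigcup_(yz in D) E yz.
  apply/seteqP; split=> w.
    by move=> Vw; exists (X t w, map_mx intr (B t.+1 w)).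
  by move=> [[y z] /= Dyz [/= Xy Bz]]; rewrite /X/= Bz -/(X t w) Xy.
apply: fin_bigcup_measurable; first exact: finite_finset.
by move=> yz _; apply: measurableI; [exact: IH|exact: measurable_preimage_RV].
Qed.

Context (mu : probability (discrete_space 'cV[int]_d) R).

Lemma measurable_surprisal_RV s :
  measurable_fun [set: Omega] (surprisal mu \o B s).
Proof.
move=> _ V mV; rewrite setTI.
exact: (@measurable_preimage_RV s (surprisal mu @^-1` V)).
Qed.

Context (B_indep : mutually_independent [set t | (1 <= t)%N] B)
  (B_law : forall t, (1 <= t)%N ->
    forall S : set (discrete_space 'cV[int]_d),
      distribution P (B t) S = mu S).

(** The event that the increments are b(1), ..., b(t) has, by independence, the
    product as its probability, and it forces the position reached by b. *)
Lemma walk_atom_ge (b : nat -> 'cV[int]_d) t :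
  (\prod_(0 <= s < t) mu [set b s.+1] <= P (X t @^-1` [set walk n A b t]))%E.
Proof.
pose J : {fset nat} := [fset s in iota 1 t]%fset.
have := @B_indep J (fun s => [set b s]).
have -> : [set` J] = [set s | (1 <= s <= t)%N].
  by apply/seteqP; split=> s /=; rewrite !inE mem_iota add1n ltnS.
have J1 : [set s | (1 <= s <= t)%N] `<=` [set s | (1 <= s)%N].
  by move=> s /= /andP[].
move=> /(_ J1 (fun _ _ => I)) PJ.
have -> : (\prod_(0 <= s < t) mu [set b s.+1] =
           \prod_(s <- J) P (B s @^-1` [set b s]))%E.
  have -> : (\prod_(s <- J) P (B s @^-1` [set b s]) =
             \prod_(s <- iota 1 t) P (B s @^-1` [set b s]))%E.
    apply: perm_big; apply: uniq_perm; rewrite ?fset_uniq ?iota_uniq//.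
    by move=> s; rewrite inE.
  rewrite -[iota 1 t]/(iota (1 + 0) t) iotaDl big_map /index_iota subn0.
  by apply: eq_bigr => s _; rewrite add1n; apply/esym/(@B_law s.+1).
rewrite -PJ; apply: le_measure; rewrite ?inE.
- apply: fin_bigcap_measurable.
    by apply: (sub_finite_set _ (finite_II t.+1)) => s /= /andP[].
  by move=> s _; exact: measurable_preimage_RV.
- exact: measurable_walk.
- move=> w Bw; apply: eq_walk => s st.
  exact: (Bw s.+1).
Qed.

(** The pointwise form of the subadditivity of entropy: [walk_atom_ge] applied to
    the realised increments. *)
Lemma neg_lne_walk_atom_le t w :
  (- lne (P (X t @^-1` [set X t w])) <=
   \sum_(0 <= s < t) surprisal mu (B s.+1 w))%E.
Proof.
have mu01 (x : 'cV[int]_d) : (0 <= mu [set x] <= 1)%E.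
  by rewrite measure_ge0 probability_le1.
rewrite /surprisal -(@neg_lne_prod _ t (fun s => mu [set B s.+1 w]))//.
rewrite leeN2 lee_lne ?walk_atom_ge// in_itv/= leey andbT//.
by apply: prode_ge0 => s _; case/andP: (mu01 (B s.+1 w)).
Qed.

Lemma integral_sum_surprisal t :
  (\int[P]_w \sum_(0 <= s < t) surprisal mu (B s.+1 w) =
   t%:R%:E * entropy mu)%E.
Proof.
rewrite ge0_integral_sum//; last 2 first.
- by move=> s; exact: measurable_surprisal_RV.
- by move=> s w _; exact: surprisal_ge0.
have int_B s : (\int[P]_w surprisal mu (B s.+1 w) = entropy mu)%E.
  rewrite -integral_surprisal; last exact: countableP.
  rewrite -(ge0_integral_distribution (B s.+1) (f := surprisal mu))//.
    by apply: eq_measure_integral => V _ _; exact: B_law.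
  exact: surprisal_ge0.
rewrite (eq_bigr (fun=> entropy mu)); last by move=> s _; exact: int_B.
by rewrite sumr_const_nat subn0 mule_natl.
Qed.
End walk.

(** * Total variation distance to the uniform measure *)

Section finite_valued.
Context (R : realType) (disp : measure_display) (Omega : measurableType disp).
Context (P : probability Omega R) (T : finType) (Y : Omega -> T).
Context (measurable_Y : forall V : set T, measurable (Y @^-1` V)).

Lemma tv_dist_ge (p q : set T -> \bar R) (S : {set T}) :
  fine (p [set` S]) - fine (q [set` S]) <= tv_dist p q.
Proof.
by apply: le_trans (ler_norm _) _; rewrite /tv_dist; apply: le_bigmax.
Qed.

Lemma card_heavy_atoms (a : R) (S : {set T}) :
  (forall x, x \in S -> a%:E <= P (Y @^-1` [set x]))%E -> #|S|%:R * a <= 1.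
Proof.
move=> heavy; rewrite -lee_fin.
have <- : (\sum_(x <- enum S) a%:E = (#|S|%:R * a)%:E)%E.
  by rewrite sumEFin big_const_seq count_predT -cardE iter_addr_0 mulr_natl.
apply: le_trans (_ : \sum_(x <- enum S) P (Y @^-1` [set x]) <= _)%E.
  rewrite big_seq [leRHS]big_seq; apply: lee_sum => x.
  by rewrite mem_enum; exact: heavy.
rewrite fsbig_seq ?enum_uniq// -measure_fin_bigcup//.
- by apply: probability_le1; apply: fin_bigcup_measurable.
- by move=> i j _ _ [w [<- <-]].
Qed.

(** The distance is tested on the set S of atoms of mass at least 1/n: the
    subtracted probability is that of Y falling outside S, and n / #|T| bounds the
    uniform measure of S, which has at most n elements. *)
Lemma tv_dist_uniform_ge (n : nat) : (0 < n)%N ->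
  1 - fine (P [set w | P (Y @^-1` [set Y w]) < n%:R^-1%:E]%E) - n%:R / #|T|%:R
  <= tv_dist (fun V => P (Y @^-1` V)) (@uniform_measure R T).
Proof.
move=> n0.
pose S : {set T} := [set x | (n%:R^-1%:E <= P (Y @^-1` [set x]))%E]%SET.
have bad_setC : [set w | P (Y @^-1` [set Y w]) < n%:R^-1%:E]%E =
    ~` (Y @^-1` [set` S]).
  apply/seteqP; split=> w /=; rewrite inE.
    by rewrite ltNge => /negP.
  by move=> /negP; rewrite -ltNge.
apply: le_trans (tv_dist_ge _ _ S); apply: lerB.
  rewrite bad_setC probability_setC// fineB//.
    by rewrite opprB addrC subrK.
  exact: fin_num_measure.
rewrite /uniform_measure /=; apply: ler_wpM2r; first by rewrite invr_ge0.
have -> : #|[set x : T | x \in [set` S]]%SET| = #|S|.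
  by apply: eq_card => x; rewrite finset.inE mem_setE.
rewrite -[leRHS]mul1r -ler_pdivrMr ?ltr0n//.
by apply: card_heavy_atoms => x; rewrite inE.
Qed.
End finite_valued.

(** * The lower bound *)

Lemma card_cV_Zp (d n : nat) : (2 <= n)%N -> #|{: 'cV['Z_n]_d}| = (n ^ d)%N.
Proof. by move=> n2; rewrite card_mx card_ord Zp_cast// muln1. Qed.

Lemma invn_le_ln2_div_ln (R : realType) (n : nat) : (2 <= n)%N ->
  n%:R^-1 <= ln 2 / ln n%:R :> R.
Proof.
move=> n2; have n0 : (0 < n)%N by rewrite ltnW.
rewrite ler_pdivlMr ?ln_gt0 ?ltr1n// mulrC ler_pdivrMr ?ltr0n//.
rewrite mulr_natr -lnXn// ler_ln ?posrE ?exprn_gt0 ?ltr0n//.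
by rewrite -natrX ler_nat ltnW// ltn_expl.
Qed.

Lemma ln_le_neg_lne (R : realType) (c : R) (a : \bar R) :
  0 < c -> (0 <= a)%E -> (a < c^-1%:E)%E -> ((ln c)%:E <= - lne a)%E.
Proof.
case: a => // a c0; rewrite lee_fin lte_fin le_eqVlt => /predU1P[<-|a0] ac.
  by rewrite (le0_lneNy (lexx _)) leey.
rewrite lne_EFin// -EFinN lee_fin lerNr -lnV//.
by rewrite ler_ln ?posrE ?invr_gt0// ltW.
Qed.

Theorem theorem2 (R : realType) (d n : nat) (hd : (2 <= d)%N) (hn : (2 <= n)%N)
    (A : 'M[int]_d) (A_unit : A \in unitmx) (A_hyp : hyperbolic R A)
    (mu : probability (discrete_space 'cV[int]_d) R)
    (mu_fin : (entropy mu < +oo)%E)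
    (disp : measure_display) (Omega : measurableType disp)
    (P : probability Omega R)
    (B : nat -> {RV P >-> discrete_space 'cV[int]_d})
    (B_indep : mutually_independent [set t | (1 <= t)%N] B)
    (B_law : forall t, (1 <= t)%N ->
       forall S : set (discrete_space 'cV[int]_d),
         distribution P (B t) S = mu S)
    (X := fun (t : nat) (w : Omega) => walk n A (fun s => B s w) t)
    (Pt := fun t : nat =>
       pushforward P (X t : Omega -> discrete_space 'cV['Z_n]_d))
    (U := @uniform_measure R 'cV['Z_n]_d)
    (t : nat) :
  tv_dist (Pt t) U >= 1 - (t%:R * fine (entropy mu) + ln 2) / ln n%:R.
Proof.
have n0 : (0 < n)%N by rewrite ltnW.
have ln_n : 0 < ln n%:R :> R by rewrite ln_gt0 ?ltr1n.
have mX := @measurable_walk R d n A disp Omega P B t.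
refine (le_trans _ (@tv_dist_uniform_ge _ _ _ P _ (X t) mX n n0)).
(* The term log 2 / log n pays for the uniform measure of the heavy atoms, and
   t H(mu) / log n for the probability of being at a light atom. *)
rewrite mulrDl opprD addrA; apply: lerB; last first.
  refine (le_trans _ (invn_le_ln2_div_ln R hn)).
  rewrite card_cV_Zp// ler_pdivrMr ?ltr0n ?expn_gt0 ?n0//.
  by rewrite ler_pdivlMl ?ltr0n// -natrM ler_nat mulnn leq_pexp2l.
apply: lerB => //; rewrite ler_pdivlMr//.
set bad := [set w | _].
pose I w := (\sum_(0 <= s < t) surprisal mu (B s.+1 w))%E.
have I0 w : (0 <= I w)%E by apply: sume_ge0 => s _; exact: surprisal_ge0.
have mI : measurable_fun [set: Omega] I.
  by apply: emeasurable_sum => s; exact: measurable_surprisal_RV.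
have mbad : measurable bad.
  exact: (mX [set x | (P (X t @^-1` [set x]) < n%:R^-1%:E)%E]).
have bad_sub : bad `<=` setT `&` [set w | ((ln n%:R)%:E <= `|I w|)%E].
  move=> w /= Pw; split=> //; rewrite gee0_abs//.
  refine (le_trans _ (neg_lne_walk_atom_le n A B_indep B_law t w)).
  by apply: ln_le_neg_lne; [rewrite ltr0n|exact: measure_ge0|exact: Pw].
have := le_integral_abse P measurableT mI ln_n.
have -> : (\int[P]_w `|I w| = t%:R%:E * entropy mu)%E.
  rewrite -(integral_sum_surprisal B_law); apply: eq_integral => w _.
  by rewrite gee0_abs.
have H_fin : entropy mu \is a fin_num.
  rewrite ge0_fin_numE// -integral_surprisal; last exact: countableP.
  by apply: integral_ge0 => x _; exact: surprisal_ge0.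
move=> markov; rewrite -lee_fin EFinM [(_ * fine _)%:E]EFinM.
rewrite fineK; last exact: fin_num_measure.
rewrite fineK//; apply: le_trans markov; rewrite muleC lee_pmul2l// ?lte_fin//.
apply: le_measure; rewrite ?inE//.
by apply: emeasurable_fun_c_infty => //; exact: measurableT_comp.
Qed.
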